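(* Let $k$ be an algebraically closed field of arbitrary characteristic, let $G$ have type $A_3$ (realized as $G=SL_4(k)$), let $B$ be a Borel subgroup of $G$ (realized as the upper triangular matrices in $G$), and let $\mathfrak{n}$ be the nilradical of the Lie algebra $\mathfrak{b}$ of $B$, i.e. the strictly upper triangular $4\times 4$ matrices, on which $B$ acts by conjugation. Let $x_1=e_{12}$, $x_2=e_{23}$, $x_3=e_{34}$, $x_{12}=e_{13}$, $x_{23}=e_{24}$, $x_{13}=e_{14}$ be the basis of root vectors of $\mathfrak{n}$, with corresponding coordinate functions $X_1,X_2,X_3,X_{12},X_{23},X_{13}$. Then $B$ has exactly $16$ orbits on $\mathfrak{n}$ (in particular $B$ has modality $0$), and they are the following, with the stated dimensions: (1) $B.0=Z(X_1,X_2,X_3,X_{12},X_{23},X_{13})$, dimension $0$; (2) $B.x_{13}=Z(X_1,X_2,X_3,X_{12},X_{23})\cap V(X_{13})$, dimension $1$; (3) $B.x_{12}=Z(X_1,X_2,X_3,X_{23})\cap V(X_{12})$, dimension $2$; (4) $B.x_{23}=Z(X_1,X_2,X_3,X_{12})\cap V(X_{23})$, dimension $2$; (5) $B.x_1=Z(X_2,X_3,X_{23})\cap V(X_1)$, dimension $3$; (6) $B.x_2=Z(X_1,X_3,X_2X_{13}-X_{12}X_{23})\cap V(X_2)$, dimension $3$; (7) $B.x_3=Z(X_1,X_2,X_{12})\cap V(X_3)$, dimension $3$; (8) $B.(x_{12}+x_{23})=Z(X_1,X_2,X_3)\cap V(X_{12},X_{23})$, dimension $3$; (9) $B.(x_2+x_{13})=Z(X_1,X_3)\cap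 V(X_2,\;X_2X_{13}-X_{12}X_{23})$, dimension $4$; (10) $B.(x_3+x_{12})=Z(X_1,X_2)\cap V(X_{12}X_3+X_1X_{23})$, dimension $4$; (11) $B.(x_1+x_{23})=Z(X_2,X_3)\cap V(X_{12}X_3+X_1X_{23})$, dimension $4$; (12) $B.(x_1+x_3)=Z(X_2,\;X_{12}X_3+X_1X_{23})\cap V(X_1,X_3)$, dimension $4$; (13) $B.(x_1+x_2)=Z(X_3)\cap V(X_1,X_2)$, dimension $5$; (14) $B.(x_2+x_3)=Z(X_1)\cap V(X_2,X_3)$, dimension $5$; (15) $B.(x_1+x_3+x_{23})=Z(X_2)\cap V(X_1,X_3,\;X_{12}X_3+X_1X_{23})$, dimension $5$; (16) $B.(x_1+x_2+x_3)=V(X_1,X_2,X_3)$, dimension $6$. Moreover, the closure of each orbit is the closed set $Z(\cdots)$ occurring in its description above (and is $\mathfrak{n}$ for the orbit (16)), so that the closure ordering on the orbits is given by the inclusions among these closed sets.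
   Context: For polynomial functions on the affine space $\mathfrak{n}$: $Z(f_1,\dots,f_m)$ is the set of common zeros of $f_1,\dots,f_m$ in $\mathfrak{n}$, and $V(g_1,\dots,g_\ell)$ is the set of points of $\mathfrak{n}$ at which every one of $g_1,\dots,g_\ell$ is nonzero. The action of $B$ on $\mathfrak{n}$ is the Adjoint action, $b.x=bxb^{-1}$. Closures and dimensions are with respect to the Zariski topology. The closure ordering is $\mathcal{O}\le\mathcal{O}'$ iff $\mathcal{O}\subseteq\overline{\mathcal{O}'}$. $B$ having modality $0$ on $\mathfrak{n}$ means that the number of $B$-orbits on $\mathfrak{n}$ is finite. Since isogenous groups have the same orbits, a group of type $A_n$ is taken to be $SL_{n+1}(k)$, with $B$ the upper triangular subgroup. $e_{ij}$ is the matrix with $1$ in position $(i,j)$ and $0$ elsewhere. *)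

(* Defs.v *)
From HB Require Import structures.
From mathcomp Require Import all_boot all_order all_algebra.
From mathcomp Require Import mpoly.
From mathcomp Require Import boolp classical_sets functions cardinality.
From mathcomp Require Import topology_structure.

Set Implicit Arguments.
Unset Strict Implicit.
Unset Printing Implicit Defensive.
Import GRing.Theory.
Local Open Scope classical_set_scope.
Local Open Scope ring_scope.

Section KrullDimension.
Variable T : topologicalType.
Implicit Types (A S : set T).

(* For A included in S, irreducibility of A does not depend on whether the
   closed sets are taken in T or in the subspace S. *)
Definition irreducible A :=
  A !=set0 /\
  forall C D : set T, closed C -> closed D -> A `<=` C `|` D ->
    A `<=` C \/ A `<=` D.

Definition closed_in S A := exists2 C, closed C & A = S `&` C.

Definition irreducible_chain S (m : nat) (c : nat -> set T) :=
  (forall i, (i <= m)%N -> closed_in S (c i) /\ irreducible (c i)) /\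
  (forall i, (i < m)%N -> c i `<` c i.+1).

(* The Krull dimension of the subspace S is d. *)
Definition has_dimension S (d : nat) :=
  (exists c, irreducible_chain S d c) /\
  (forall m c, irreducible_chain S m c -> (m <= d)%N).

End KrullDimension.

Section Nilradical.
Variable k : closedFieldType.

Definition SL4 : {pred 'M[k]_4} := [pred g | \det g == 1].

(* is_trig_mx is lower triangularity. *)
Definition borel : {pred 'M[k]_4} := [pred b | (b \in SL4) && is_trig_mx b^T].

Definition strict_upper : {pred 'M[k]_4} :=
  [pred x : 'M[k]_4 | [forall i : 'I_4, forall j : 'I_4,
                         (j <= i)%N ==> (x i j == 0)]].

Lemma strict_upperP (x : 'M[k]_4) :
  reflect (forall i j : 'I_4, (j <= i)%N -> x i j = 0) (x \in strict_upper).
Proof.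
apply: (iffP forallP) => [+ i j ji|x0 i].
  by move=> /(_ i)/forallP/(_ j)/implyP/(_ ji)/eqP.
by apply/forallP => j; apply/implyP => ji; rewrite x0.
Qed.

Lemma strict_upper_submod_closed : submod_closed strict_upper.
Proof.
split=> [|a x y /strict_upperP x0 /strict_upperP y0].
  by apply/strict_upperP => i j _; rewrite mxE.
by apply/strict_upperP => i j ji; rewrite !mxE x0 // y0 // mulr0 addr0.
Qed.

HB.instance Definition _ :=
  GRing.isSubmodClosed.Build k 'M[k]_4 strict_upper strict_upper_submod_closed.

Record nilradical :=
  Nilradical { nil_mx :> 'M[k]_4; _ : nil_mx \in strict_upper }.

HB.instance Definition _ := [isSub for nil_mx].
HB.instance Definition _ := [Choice of nilradical by <:].
HB.instance Definition _ := [SubChoice_isSubLmodule of nilradical by <:].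

Definition idx1 : 'I_4 := @Ordinal 4 0 isT.
Definition idx2 : 'I_4 := @Ordinal 4 1 isT.
Definition idx3 : 'I_4 := @Ordinal 4 2 isT.
Definition idx4 : 'I_4 := @Ordinal 4 3 isT.

Lemma delta_strict_upper (i j : 'I_4) :
  (i < j)%N -> delta_mx i j \in strict_upper.
Proof.
move=> ij; apply/strict_upperP => a b ba; rewrite mxE.
case: eqP => //= ai; case: eqP => //= bj.
by move: ba; rewrite ai bj leqNgt ij.
Qed.

Definition root_vector (i j : 'I_4) (ij : (i < j)%N) : nilradical :=
  Nilradical (delta_strict_upper ij).

Definition x1 := @root_vector idx1 idx2 isT.
Definition x2 := @root_vector idx2 idx3 isT.
Definition x3 := @root_vector idx3 idx4 isT.
Definition x12 := @root_vector idx1 idx3 isT.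
Definition x23 := @root_vector idx2 idx4 isT.
Definition x13 := @root_vector idx1 idx4 isT.

(* Polynomial functions on the nilradical are given by polynomials in six
   variables; the l-th variable is the matrix entry at position
   tnth coord_pos l. *)
Definition coord_pos : 6.-tuple ('I_4 * 'I_4) :=
  [tuple (idx1, idx2); (idx2, idx3); (idx3, idx4);
         (idx1, idx3); (idx2, idx4); (idx1, idx4)].

Definition nil_coord (x : nilradical) (l : 'I_6) : k :=
  nil_mx x (tnth coord_pos l).1 (tnth coord_pos l).2.

Definition X1 : {mpoly k[6]} := 'X_(@Ordinal 6 0 isT).
Definition X2 : {mpoly k[6]} := 'X_(@Ordinal 6 1 isT).
Definition X3 : {mpoly k[6]} := 'X_(@Ordinal 6 2 isT).
Definition X12 : {mpoly k[6]} := 'X_(@Ordinal 6 3 isT).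
Definition X23 : {mpoly k[6]} := 'X_(@Ordinal 6 4 isT).
Definition X13 : {mpoly k[6]} := 'X_(@Ordinal 6 5 isT).

Definition polyfun (f : {mpoly k[6]}) (x : nilradical) : k := f.@[nil_coord x].

Definition zero_locus (F : set {mpoly k[6]}) : set nilradical :=
  [set x | forall f, F f -> polyfun f x = 0].

Definition Z (fs : seq {mpoly k[6]}) : set nilradical := zero_locus [set` fs].

Definition V (gs : seq {mpoly k[6]}) : set nilradical :=
  [set x | forall g, g \in gs -> polyfun g x != 0].

Lemma Z_nil : Z [::] = setT.
Proof. by apply/seteqP; split=> x. Qed.

Lemma V_nil : V [::] = setT.
Proof. by apply/seteqP; split=> x. Qed.

Definition zariski_open (A : set nilradical) := exists F, A = ~` zero_locus F.

Lemma setC_zero_locus (F : set {mpoly k[6]}) x :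
  (~` zero_locus F) x <-> exists2 f, F f & polyfun f x != 0.
Proof.
split=> [/existsNP[f /not_implyP[Ff /eqP fx]]|[f Ff /eqP fx] /(_ f Ff)//].
by exists f.
Qed.

Lemma zariski_openT : zariski_open setT.
Proof.
exists [set 1]; apply/esym/seteqP; split=> // x _; apply/setC_zero_locus.
by exists 1; rewrite // /polyfun meval1 oner_neq0.
Qed.

Lemma zariski_openI : setI_closed zariski_open.
Proof.
move=> _ _ [F ->] [G ->]; exists [set f * g | f in F & g in G].
apply/seteqP; split=> [x [/setC_zero_locus[f Ff fx] /setC_zero_locus[g Gg gx]]|].
  apply/setC_zero_locus; exists (f * g); first by exists f => //; exists g.
  by rewrite /polyfun mevalM mulf_neq0.
move=> x /setC_zero_locus[_ [f Ff [g Gg <-]]].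
rewrite /polyfun mevalM mulf_eq0 negb_or => /andP[fx gx].
by split; apply/setC_zero_locus; [exists f|exists g].
Qed.

Lemma zariski_open_bigU (I : Type) (A : I -> set nilradical) :
  (forall i, zariski_open (A i)) -> zariski_open (\bigcup_i A i).
Proof.
move=> /choice[F AF]; exists (\bigcup_i F i); apply/seteqP; split=> x.
  move=> [i _]; rewrite AF => /setC_zero_locus[f Ff fx].
  by apply/setC_zero_locus; exists f => //; exists i.
move=> /setC_zero_locus[f [i _ Ff] fx]; exists i => //.
by rewrite AF; apply/setC_zero_locus; exists f.
Qed.

HB.instance Definition _ := isOpenTopological.Build nilradical
  zariski_openT zariski_openI zariski_open_bigU.

Lemma closed_zero_locusP (A : set nilradical) :
  closed A <-> exists F, A = zero_locus F.
Proof.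
rewrite -openC; split=> [[F AF]|[F ->]]; last by exists F.
by exists F; apply: setC_inj.
Qed.

Definition Borbit (x : nilradical) : set nilradical :=
  [set y | exists2 b, b \in borel & nil_mx y = b *m nil_mx x *m invmx b].

Definition Borbits : set (set nilradical) := range Borbit.

Definition modality0 := finite_set Borbits.

Definition orbit_le (O O' : set nilradical) := O `<=` closure O'.

Record orbit_row := OrbitRow {
  rep : nilradical;
  zeros : seq {mpoly k[6]};
  nonzeros : seq {mpoly k[6]};
  dimension : nat }.

Definition orbit_table : 16.-tuple orbit_row := [tuple
  OrbitRow 0 [:: X1; X2; X3; X12; X23; X13] [::] 0;
  OrbitRow x13 [:: X1; X2; X3; X12; X23] [:: X13] 1;
  OrbitRow x12 [:: X1; X2; X3; X23] [:: X12] 2;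
  OrbitRow x23 [:: X1; X2; X3; X12] [:: X23] 2;
  OrbitRow x1 [:: X2; X3; X23] [:: X1] 3;
  OrbitRow x2 [:: X1; X3; X2 * X13 - X12 * X23] [:: X2] 3;
  OrbitRow x3 [:: X1; X2; X12] [:: X3] 3;
  OrbitRow (x12 + x23) [:: X1; X2; X3] [:: X12; X23] 3;
  OrbitRow (x2 + x13) [:: X1; X3] [:: X2; X2 * X13 - X12 * X23] 4;
  OrbitRow (x3 + x12) [:: X1; X2] [:: X12 * X3 + X1 * X23] 4;
  OrbitRow (x1 + x23) [:: X2; X3] [:: X12 * X3 + X1 * X23] 4;
  OrbitRow (x1 + x3) [:: X2; X12 * X3 + X1 * X23] [:: X1; X3] 4;
  OrbitRow (x1 + x2) [:: X3] [:: X1; X2] 5;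
  OrbitRow (x2 + x3) [:: X1] [:: X2; X3] 5;
  OrbitRow (x1 + x3 + x23) [:: X2] [:: X1; X3; X12 * X3 + X1 * X23] 5;
  OrbitRow (x1 + x2 + x3) [::] [:: X1; X2; X3] 6].

End Nilradical.

Arguments SL4 : clear implicits.
Arguments borel : clear implicits.
Arguments strict_upper : clear implicits.
Arguments Borbits : clear implicits.

(* Main.v *)
Require Import Defs.
From mathcomp Require Import all_boot all_order all_algebra.
From mathcomp Require Import mpoly zify ring.
From mathcomp Require Import boolp classical_sets functions cardinality.
From mathcomp Require Import topology_structure.

(* Every B-orbit is computed from the equation [y *m b = b *m x]: its six
   nontrivial entries can be solved for the entries of [y], and [b] need only be
   invertible upper triangular, since it can be rescaled to determinant 1.

   Upper bound for the dimension of a subset S of the image of a polynomial map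
   from k^n: along a chain of irreducible sets [c 0 < ... < c m] in S, choose
   polynomial functions [f i] vanishing on [c i] but not on [c i.+1]. They are
   algebraically independent on [c m], so their pullbacks to k^n are m
   algebraically independent polynomials in n variables, whence [m <= n] by
   counting monomials.

   Lower bound: starting from a parametrization of S, impose on one parameter
   after another the value that it takes at the representative of the orbit. *)

Set Implicit Arguments.
Unset Strict Implicit.
Unset Printing Implicit Defensive.
Import GRing.Theory.
Local Open Scope classical_set_scope.
Local Open Scope ring_scope.

(** * Polynomials in several variables *)

Local Notation widen := (widen_ord (leqnSn _)).

Lemma widen_lift n (i : 'I_n) : widen i = lift ord_max i.
Proof. by apply/val_inj; rewrite /= /bump leqNgt ltn_ord. Qed.

Lemma meval_muni n (R : comNzRingType) (p : {mpoly R[n.+1]}) (v : 'I_n.+1 -> R) :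
  p.@[v] = (map_poly (meval (v \o widen)) (muni p)).[v ord_max].
Proof.
rewrite mevalE muniE raddf_sum horner_sum /=; apply: eq_bigr => m _.
rewrite map_polyZ /= mevalZ mevalX map_polyXn hornerZ hornerXn.
rewrite -mulrA big_ord_recr /=; congr (_ * (_ * _)).
by apply: eq_bigr => i _; rewrite mnmE.
Qed.

(** [muni] loses no information: the coefficient of [p] at [m] reappears inside the coefficient of
    [muni p] in degree [m ord_max]. *)
Lemma muni_eq0 n (R : nzRingType) (p : {mpoly R[n.+1]}) :
  (muni p == 0) = (p == 0).
Proof.
apply/eqP/eqP => [p0|->]; last exact: raddf0.
apply/mpolyP => m; rewrite mcoeff0.
transitivity ((muni p)`_(m ord_max))@_[multinom m (widen i) | i < n]; last first.
  by rewrite p0 coef0 mcoeff0.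
rewrite {1}[p]mpolyE muniE coef_sum !raddf_sum /=; apply: eq_bigr => a _.
rewrite mcoeffZ mcoeffX coefZ coefXn.
case: (eqVneq (m ord_max)) => ma; last first.
  rewrite mulr0 mcoeff0; case: eqVneq => [am|]; last by rewrite mulr0.
  by rewrite am eqxx in ma.
rewrite mulr1 mcoeffZ mcoeffX; congr (_ * _%:R); congr nat_of_bool.
apply/eqP/eqP => [->//|/mnmP am]; apply/mnmP => i.
have [j ->|->] := unliftP ord_max i; last by rewrite ma.
by have := am j; rewrite !mnmE widen_lift.
Qed.

(** Induction on the number of variables: where the leading coefficient in the last variable is
    nonzero, a nonzero univariate polynomial remains, and it has a nonroot because [k] is
    infinite. *)
Lemma exists_nonroot n (k : closedFieldType) (p : {mpoly k[n]}) :
  p != 0 -> exists v, p.@[v] != 0.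
Proof.
elim: n p => [|n IHn] p p0.
  exists (fun=> 0); apply: contraNneq p0 => pv.
  have pC : p = (p@_0)%:MP.
    apply/mpolyP => m; rewrite mcoeffC.
    have -> : m = 0%MM by apply/mnmP => -[].
    by rewrite eqxx mulr1.
  by move: pv; rewrite pC mevalC => ->.
have /IHn[v lv] : lead_coef (muni p) != 0 by rewrite lead_coef_eq0 muni_eq0.
have : map_poly (meval v) (muni p) != 0.
  apply: contraNneq lv => q0.
  by rewrite lead_coefE -(coef_map (meval v)) q0 coef0.
case/closed_nonrootP => y py.
exists (fun i => oapp v y (unlift ord_max i)); rewrite meval_muni /= unlift_none /=.
rewrite (_ : _ \o _ = v) //; apply/funext => i /=.
by rewrite widen_lift liftK.
Qed.

Lemma eval0_mpoly n (k : closedFieldType) (p : {mpoly k[n]}) :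
  (forall v, p.@[v] = 0) -> p = 0.
Proof.
by move=> pv; apply/eqP; apply: contraT => /exists_nonroot[v]; rewrite pv eqxx.
Qed.

(** [(msize p).-1] is the total degree, with value 0 at the zero polynomial, where only an
    inequality survives. *)
Lemma msizeM_pred n (R : idomainType) (p q : {mpoly R[n]}) :
  ((msize (p * q)).-1 <= (msize p).-1 + (msize q).-1)%N.
Proof.
have [->|p0] := eqVneq p 0; first by rewrite mul0r msize0.
have [->|q0] := eqVneq q 0; first by rewrite mulr0 msize0.
rewrite msizeM //.
move: p0 q0; rewrite -!(mmeasure_poly_eq0 mdeg).
by case: (msize p) => // a; case: (msize q) => // b _ _; rewrite addnS.
Qed.

Lemma msizeX_pred n (R : idomainType) (p : {mpoly R[n]}) e :
  ((msize (p ^+ e)).-1 <= e * (msize p).-1)%N.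
Proof.
elim: e => [|e IHe]; first by rewrite expr0 msize1.
by rewrite exprS mulSn (leq_trans (msizeM_pred _ _)) ?leq_add2l.
Qed.

(* There are more monomials with all exponents below N in m variables than
   monomials that can occur in their images in n variables. *)
Lemma algebraically_dependent m n (k : fieldType) (g : 'I_m -> {mpoly k[n]}) :
  (n < m)%N ->
  exists2 P : {mpoly k[m]}, P != 0 & P \mPo [tuple g i | i < m] = 0.
Proof.
move=> nm.
(* [D] bounds the degrees of the [g i], so a monomial with exponents below [N] has an image with
   exponents below [M]. As [M <= (m * D).+1 * N], this choice of [N] gives
   [M ^ n < N ^ n.+1 <= N ^ m]. *)
pose D := (\max_i (msize (g i)).-1)%N.
pose N := ((m * D).+1 ^ n).+1%N.
pose M := (m * N * D).+1%N.
pose I := {ffun 'I_m -> 'I_N}; pose J := {ffun 'I_n -> 'I_M}.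
have cardJI : (#|J| < #|I|)%N.
  rewrite !card_ffun !card_ord.
  have MN : (M <= (m * D).+1 * N)%N by rewrite /M mulSn mulnAC; lia.
  apply: (@leq_ltn_trans (((m * D).+1 * N) ^ n)).
    by case: (n) => // n'; rewrite leq_exp2r.
  rewrite expnMn.
  apply: (@leq_trans (N * N ^ n)); last by rewrite -expnS leq_pexp2l.
  by rewrite ltn_pmul2r // expn_gt0.
pose mI (e : I) := [multinom (e i : nat) | i < m].
pose mJ (a : J) := [multinom (a i : nat) | i < n].
pose G := [tuple g i | i < m].
(* Row [i] holds the coefficients of the image of the [i]-th monomial. With more rows than columns
   there is a nonzero [v] with [v *m A = 0], whose entries become the coefficients of [P]. *)
pose A := \matrix_(i < #|I|, j < #|J|)
  ('X_[mI (enum_val i)] \mPo G)@_(mJ (enum_val j)).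
have : ~~ row_free A.
  apply/negP; rewrite /row_free => /eqP rA.
  by have := rank_leq_col A; rewrite rA leqNgt cardJI.
rewrite -kermx_eq0 => /rowV0Pn[v /sub_kermxP vA v0].
pose P : {mpoly k[m]} := \sum_i v 0 i *: 'X_[mI (enum_val i)].
have mI_inj : injective mI.
  move=> e e' /mnmP ee'; apply/ffunP => i; apply: val_inj.
  by have := ee' i; rewrite !mnmE.
exists P.
  apply: contraNneq v0 => P0; apply/eqP/rowP => i; rewrite mxE.
  have := congr1 (mcoeff (mI (enum_val i))) P0.
  rewrite mcoeff0 raddf_sum /= (bigD1 i) //= mcoeffZ mcoeffX eqxx mulr1.
  rewrite big1 ?addr0 // => j ji; rewrite mcoeffZ mcoeffX.
  by rewrite (inj_eq mI_inj) (inj_eq enum_val_inj) (negbTE ji) mulr0.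
apply/mpolyP => a; rewrite mcoeff0 /P.
rewrite [X in X@_a](linear_sum (comp_mpoly G)) raddf_sum /=.
have [aM|aM] := boolP [forall i, (a i < M)%N].
  pose b : J := [ffun i => inord (a i)].
  have -> : a = mJ b.
    by apply/mnmP => i; rewrite mnmE ffunE inordK //; apply: (forallP aM).
  have /rowP/(_ (enum_rank b)) := vA; rewrite !mxE => vAb.
  rewrite -[RHS]vAb; apply: eq_bigr => i _.
  by rewrite comp_mpolyZ mcoeffZ mxE enum_rankK.
(* Here some exponent of [a] is at least [M], beyond the degree of every image. *)
apply: big1 => i _; rewrite comp_mpolyZ mcoeffZ comp_mpolyX.
set q := \prod_(_ < _) _.
suff : (msize q <= mdeg a)%N.
  by move/msize_mdeg_ge/memN_msupp_eq0 => ->; rewrite mulr0.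
have qM : ((msize q).-1 <= m * N * D)%N.
  have -> : (m * N * D = \sum_(j < m) N * D)%N.
    by rewrite sum_nat_const card_ord mulnA.
  rewrite /q; elim/big_ind2: _ => [|p s p' s' ps ps'|j _].
  - by rewrite msize1.
  - by rewrite (leq_trans (msizeM_pred _ _)) ?leq_add.
  rewrite tnth_mktuple (leq_trans (msizeX_pred _ _)) // mnmE.
  by rewrite leq_mul //; [apply/ltnW/ltn_ord|apply: leq_bigmax].
move: aM; rewrite negb_forall => /existsP[j]; rewrite -leqNgt => aj.
have : (a j <= mdeg a)%N by rewrite mdegE (bigD1 j) //= leq_addr.
rewrite /M in aj; lia.
Qed.

(** * Chains of irreducible sets *)

Section Dimension.
Variable k : closedFieldType.
Local Notation nilr := (nilradical k).
Implicit Types (A S : set nilr) (f g : {mpoly k[6]}) (x : nilr).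

Definition vanishes f A := forall x, A x -> polyfun f x = 0.

Lemma vanishesP f A : A `<=` zero_locus [set f] <-> vanishes f A.
Proof.
split=> [Af x /Af/(_ f)->//|Af x Ax _ ->]; exact: Af.
Qed.

Lemma zero_locus_closed (F : set {mpoly k[6]}) : closed (zero_locus F).
Proof. by apply/closed_zero_locusP; exists F. Qed.

Lemma irreducible_vanishes A f g :
  irreducible A -> vanishes (f * g) A -> vanishes f A \/ vanishes g A.
Proof.
move=> [_ Airr] Afg; rewrite -!vanishesP.
apply: Airr; try exact: zero_locus_closed.
move=> x /Afg; rewrite /polyfun mevalM => /eqP; rewrite mulf_eq0.
by case/orP => /eqP ?; [left|right] => _ ->.
Qed.

Lemma irreducible_vanishesX A f n :
  irreducible A -> vanishes (f ^+ n) A -> vanishes f A.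
Proof.
move=> Airr; elim: n => [Af|n IHn].
  have [[x Ax] _] := Airr; have /eqP := Af x Ax.
  by rewrite expr0 /polyfun meval1 oner_eq0.
by rewrite exprS => /(irreducible_vanishes Airr)[|/IHn].
Qed.

(* The lowest nonzero coefficient of P in its last variable can be evaluated on
   c m, where the last function vanishes. *)
Lemma chain_independent m (c : nat -> set nilr) (f : nat -> {mpoly k[6]}) :
  (forall i, (i <= m)%N -> irreducible (c i)) ->
  (forall i, (i < m)%N ->
     [/\ c i `<=` c i.+1, vanishes (f i) (c i) & ~ vanishes (f i) (c i.+1)]) ->
  forall P : {mpoly k[m]}, P != 0 ->
    ~ vanishes (P \mPo [tuple f i | i < m]) (c m).
Proof.
elim: m => [|m IHm] cirr cf P P0 Pc.
  have [[x cx] _] := cirr 0 (leqnn _).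
  have [v] := exists_nonroot P0; apply/negP; rewrite negbK.
  have := Pc x cx; rewrite /polyfun comp_mpoly_meval => <-.
  by apply/eqP/meval_eq => -[].
pose F : m.-tuple {mpoly k[6]} := [tuple f i | i < m].
(* This writes [muni P] as [q * 'X^e] with [q.[0] != 0], so that substituting the functions into [P]
   gives [Q * f m ^+ e]. *)
have [e [q]] := multiplicity_XsubC (muni P) 0.
rewrite muni_eq0 P0 /= subr0 => q0 Pq.
pose Q := (map_poly (comp_mpoly F) q).[f m].
have [cS fc fSc] := cf m (leqnn _).
have QE x : polyfun Q x =
    (map_poly (meval (fun i : 'I_m => polyfun (f i) x)) q).[polyfun (f m) x].
  rewrite /Q /polyfun -horner_map -map_poly_comp; congr (_.[_]).
  apply: eq_map_poly => p /=; rewrite comp_mpoly_meval.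
  by apply: meval_eq => i; rewrite tnth_mktuple.
have : vanishes (Q * f m ^+ e) (c m.+1).
  move=> x /Pc; rewrite {1}/polyfun comp_mpoly_meval [meval _ P]meval_muni Pq.
  rewrite rmorphM rmorphXn /= map_polyX hornerM hornerXn tnth_mktuple => PQ.
  rewrite /polyfun mevalM rmorphXn /= -[RHS]PQ; congr (_ * _).
  rewrite -/(polyfun Q x) QE /polyfun; congr (_.[_]).
  apply: eq_map_poly => p; apply: meval_eq => i.
  by rewrite /= tnth_mktuple.
(* As [f m] does not vanish on [c m.+1], irreducibility forces [Q] to vanish there. On [c m] the
   function [Q] reduces to [q.[0]] at the first [m] functions, against the induction hypothesis. *)
move/(irreducible_vanishes (cirr _ (leqnn _))) => [Qc|/irreducible_vanishesX fc'].
  apply: (IHm _ _ q.[0]) => [i im|i im||].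
  - exact: cirr (leqW im).
  - exact: cf (leqW im).
  - by rewrite /root in q0.
  move=> x cx; have := Qc x (cS x cx); rewrite QE (fc x cx).
  rewrite /polyfun comp_mpoly_meval => <-.
  have -> : (fun i => (tnth F i).@[nil_coord x]) =
      fun i : 'I_m => polyfun (f i) x.
    by apply/funext => i; rewrite tnth_mktuple.
  by rewrite -horner_map rmorph0.
by apply: fSc; apply: fc'; apply: cirr.
Qed.

Definition nil_of (u : 'I_6 -> k) : 'M[k]_4 :=
  \sum_l u l *: delta_mx (tnth coord_pos l).1 (tnth coord_pos l).2.

Lemma nil_of_subproof u : nil_of u \in strict_upper k.
Proof.
apply: rpred_sum => l _; apply: rpredZ; apply: delta_strict_upper.
by move: l; do 6?[case=> [] //]; case; do 6?[case => //].
Qed.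

Definition nil_vec u : nilr := Nilradical (nil_of_subproof u).

Lemma nil_vecK u l : nil_coord (nil_vec u) l = u l.
Proof.
rewrite /nil_coord /= /nil_of summxE (bigD1 l) //= mxE mxE !eqxx mulr1.
rewrite big1 ?addr0 // => j jl; rewrite mxE mxE -xpair_eqE -!surjective_pairing.
rewrite !(tnth_nth (idx1, idx1)) nth_uniq ?size_tuple //.
by rewrite (inj_eq val_inj) eq_sym (negbTE jl) mulr0.
Qed.

Lemma nil_coord_inj x y : nil_coord x =1 nil_coord y -> x = y.
Proof.
move=> xy; apply/val_inj/matrixP => i j.
have [ji|ij] := leqP j i.
  by have /strict_upperP -> := valP x => //; have /strict_upperP -> := valP y.
have : (i, j) \in coord_pos.
  by case: i j ij => -[|[|[|[|i]]]] hi // [[|[|[|[|j]]]] hj].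
by case/tnthP => l ijl; have := xy l; rewrite /nil_coord -ijl.
Qed.

Definition polymap n (F : 6.-tuple {mpoly k[n]}) (t : 'I_n -> k) : nilr :=
  nil_vec (fun l => (tnth F l).@[t]).

Lemma polyfun_polymap n (F : 6.-tuple {mpoly k[n]}) f t :
  polyfun f (polymap F t) = (f \mPo F).@[t].
Proof. by rewrite comp_mpoly_meval; apply: meval_eq => l; rewrite nil_vecK. Qed.

Lemma chain_length n (F : 6.-tuple {mpoly k[n]}) S m c :
  S `<=` range (polymap F) -> irreducible_chain S m c -> (m <= n)%N.
Proof.
move=> SF [Sc cS]; rewrite leqNgt; apply/negP => nm.
have /choice[f fP] i : exists f, (i < m)%N ->
    [/\ c i `<=` c i.+1, vanishes f (c i) & ~ vanishes f (c i.+1)].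
  have [im|] := boolP (i < m)%N; last by exists 0.
  have [[_ /closed_zero_locusP[G ->] ciG] _] := Sc i (ltnW im).
  have [cci cNc] := cS i im.
  (* Both sets lie in [S], where [G] cuts out [c i]; strictness makes some equation in [G] fail on
     [c i.+1]. *)
  have /existsNP[f /existsNP[Gf cf]] : ~ (forall f, G f -> vanishes f (c i.+1)).
    move=> cG; apply: cNc => x cx; rewrite ciG; split.
      by have [[C _ cC] _] := Sc i.+1 im; move: cx; rewrite cC => -[].
    by move=> f Gf; exact: cG cx.
  exists f => _; split => // x; rewrite ciG => -[_]; exact.
pose g i : {mpoly k[n]} := f i \mPo F.
have [P P0 Pg] := algebraically_dependent (fun i : 'I_m => g i) nm.
apply: (chain_independent (m := m) (c := c) (f := f) _ fP P0).
  by move=> i /Sc[].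
move=> x cx; have [[C _ cC] _] := Sc m (leqnn m).
have [t _ <-] : range (polymap F) x by apply: SF; move: cx; rewrite cC => -[].
rewrite polyfun_polymap.
transitivity ((P \mPo [tuple g i | i < m]).@[t]); last by rewrite Pg meval0.
rewrite comp_mpoly_meval [RHS]comp_mpoly_meval comp_mpoly_meval; apply: meval_eq => i.
by rewrite !tnth_mktuple comp_mpoly_meval.
Qed.

End Dimension.

(** * Parametrized sets *)

Section Param.
Variable k : closedFieldType.
Local Notation nilr := (nilradical k).
Implicit Types (A S : set nilr) (f g : {mpoly k[6]}) (x : nilr).

Lemma Z_closed (fs : seq {mpoly k[6]}) : closed (Z fs).
Proof. exact: zero_locus_closed. Qed.

(** If equations [f] and [g] of the two closed sets each fail somewhere on [A], the product of their
    pullbacks with [h] is a nonzero polynomial; a nonroot of it maps to a point of [A] outside both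
    sets. *)
Lemma irreducible_param n (F : 6.-tuple {mpoly k[n]}) (h : {mpoly k[n]}) A :
  h != 0 -> (forall t, h.@[t] != 0 -> A (polymap F t)) ->
  A `<=` range (polymap F) -> irreducible A.
Proof.
move=> h0 hA AF; split.
  by have [t ht] := exists_nonroot h0; exists (polymap F t); exact: hA.
move=> C D /closed_zero_locusP[I ->] /closed_zero_locusP[J ->] ACD.
apply: contrapT => /not_orP[AI AJ].
have ex (K : set {mpoly k[6]}) : ~ A `<=` zero_locus K ->
    exists2 f, K f & f \mPo F != 0.
  move=> /existsNP[x /not_implyP[Ax /existsNP[f /not_implyP[Kf /eqP fx]]]].
  exists f => //; have [t _ tx] := AF x Ax.
  by apply: contraNneq fx => fF; rewrite -tx polyfun_polymap fF meval0.
have [f If f0] := ex _ AI; have [g Jg g0] := ex _ AJ.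
have : (f \mPo F) * (g \mPo F) * h != 0 by rewrite !mulf_neq0.
case/exists_nonroot => t; rewrite !mevalM !mulf_eq0 !negb_or.
rewrite -!polyfun_polymap => /andP[/andP[ft gt] /hA/ACD].
by case=> [/(_ f If)|/(_ g Jg)] /eqP; [rewrite (negbTE ft)|rewrite (negbTE gt)].
Qed.

(** Taking a product turns membership in [V gs] into the nonvanishing of one polynomial in the
    parameters. *)
Definition pullback n (F : 6.-tuple {mpoly k[n]}) (gs : seq {mpoly k[6]}) :=
  \prod_(g <- gs) (g \mPo F).

Lemma V_polymap n (F : 6.-tuple {mpoly k[n]}) gs t :
  V gs (polymap F t) <-> (pullback F gs).@[t] != 0.
Proof.
rewrite /pullback rmorph_prod prodf_seq_neq0; split=> [Vt|/allP Vt g /Vt] /=.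
  by apply/allP => g /Vt; rewrite polyfun_polymap.
by rewrite polyfun_polymap.
Qed.

(** If [f] vanishes on the intersection, its pullback times that of [gs] is zero. The second factor
    is nonzero since the intersection is nonempty, so [f] vanishes on all of [Z fs]. *)
Lemma closure_param n (F : 6.-tuple {mpoly k[n]}) fs gs :
  (forall t, Z fs (polymap F t)) -> Z fs `<=` range (polymap F) ->
  Z fs `&` V gs !=set0 -> closure (Z fs `&` V gs) = Z fs.
Proof.
move=> FZ ZF [r [Zr Vr]]; apply/seteqP; split.
  rewrite closureE; apply: smallest_sub; [exact: Z_closed|exact: subIsetl].
move=> x Zx; rewrite closureE => C [/closed_zero_locusP[I ->] SI] f If.
have [t _ <-] := ZF x Zx; rewrite polyfun_polymap.
have [r' _ r'r] := ZF r Zr.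
have /eqP : (f \mPo F) * pullback F gs = 0.
  apply: eval0_mpoly => u; apply/eqP; rewrite mevalM mulf_eq0.
  have [//|/V_polymap Vu] := eqVneq (pullback F gs).@[u] 0; first by rewrite orbT.
  rewrite -polyfun_polymap SI ?eqxx //; split => //; exact: FZ.
rewrite mulf_eq0 => /orP[/eqP->|/eqP h0]; first exact: meval0.
by move: Vr; rewrite -r'r => /V_polymap; rewrite h0 meval0 eqxx.
Qed.

(** This makes the inclusions in the lower bound strict. On the line through [p] in direction [i],
    [h] times ['X_i - p i] is a nonzero polynomial. *)
Lemma nonroot_off n (h : {mpoly k[n]}) (p : 'I_n -> k) (i : 'I_n) :
  h.@[p] != 0 ->
  exists t, [/\ h.@[t] != 0, t i != p i & forall j, j != i -> t j = p j].
Proof.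
move=> hp; pose U := [tuple if j == i then 'X_i else (p j)%:MP | j < n].
have UE t : (h \mPo U).@[t] = h.@[fun j => if j == i then t j else p j].
  rewrite comp_mpoly_meval; apply: meval_eq => j; rewrite tnth_mktuple.
  by case: eqP => [->|_]; rewrite ?mevalXU ?mevalC.
have : (h \mPo U) * ('X_i - (p i)%:MP) != 0.
  apply: mulf_neq0.
    apply: contraNneq hp => hU; have := UE p; rewrite hU meval0 => /esym hp.
    by rewrite -hp; apply/eqP/meval_eq => j; case: ifP.
  apply/negP => /eqP/(congr1 (meval (fun=> p i + 1))).
  rewrite mevalB mevalXU mevalC meval0 addrAC subrr add0r => /eqP.
  by rewrite oner_eq0.
case/exists_nonroot => t; rewrite mevalM mevalB mevalXU mevalC mulf_eq0 negb_or.
rewrite UE subr_eq0 => /andP[ht ti].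
exists (fun j => if j == i then t j else p j); split => //; first by rewrite eqxx.
by move=> j /negbTE ->.
Qed.

(* The parameters [t j] can be fixed one after another, in decreasing order of j,
   by fixing the coordinates [s j]. *)
Lemma dimension_param n (F : 6.-tuple {mpoly k[n]}) (s : 'I_n -> 'I_6) fs gs r :
  let p j := nil_coord r (s j) in
  (forall t, Z fs (polymap F t)) ->
  (Z fs `&` V gs) r ->
  Z fs `&` V gs `<=` range (polymap F) ->
  (forall t (j : 'I_n), (forall l : 'I_n, (j < l)%N -> t l = p l) ->
     nil_coord (polymap F t) (s j) = p j <-> t j = p j) ->
  has_dimension (Z fs `&` V gs) n.
Proof.
move=> p FZ Sr SF triang; set S := Z fs `&` V gs.
(* Fixing the coordinates [s j] from [i] on amounts to fixing the parameters from [i] on. Recovering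
   the parameters goes by induction on [n - j], from the largest index down. *)
have coordP t i :
    (forall j : 'I_n, (i <= j)%N -> nil_coord (polymap F t) (s j) = p j) <->
    (forall j : 'I_n, (i <= j)%N -> t j = p j).
  split=> tp j; last first.
    by move=> ij; apply/triang => [l jl|]; apply: tp => //; lia.
  have [m] := ubnP (n - j)%N; elim: m j => // m IHm j jm ij.
  by apply/triang => [l jl|]; [apply: IHm; have := ltn_ord j; lia|apply: tp].
have hp : (pullback F gs).@[p] != 0.
  have [t _ tr] := SF r Sr; have tp : t = p.
    apply/funext => j; apply: (iffLR (coordP t 0%N)) => // l _.
    by rewrite tr.
  by apply/V_polymap; rewrite -tp tr; case: Sr.
split; last by move=> m c; apply: (chain_length SF).
(* In [c i] the first [i] parameters are free: [c 0] is the point [r] and [c n] is [S]. *)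
pose c i := S `&` [set x | forall j : 'I_n, (i <= j)%N -> nil_coord x (s j) = p j].
exists c; split=> i i_n.
  split.
    exists [set x | forall j : 'I_n, (i <= j)%N -> nil_coord x (s j) = p j] => //.
    apply/closed_zero_locusP.
    exists [set 'X_(s j) - (p j)%:MP | j in [set j : 'I_n | (i <= j)%N]].
    apply/seteqP; split=> x /= xp.
      move=> _ [j ij <-]; rewrite /polyfun mevalB mevalXU mevalC xp ?subrr //.
    move=> j ij; apply/eqP; rewrite -subr_eq0.
    have := xp _ (ex_intro2 _ _ j ij erefl).
    by rewrite /polyfun mevalB mevalXU mevalC => ->.
  (* [F'] is [F] with the parameters from [i] on frozen at [p]; its image contains [c i]. *)
  pose U := [tuple if (j < i)%N then 'X_j else (p j)%:MP | j < n].
  pose F' := [tuple tnth F l \mPo U | l < 6].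
  have F'E t : polymap F' t =
      polymap F (fun j : 'I_n => if (j < i)%N then t j else p j).
    apply: nil_coord_inj => l; rewrite !nil_vecK tnth_mktuple comp_mpoly_meval.
    apply: meval_eq => j; rewrite tnth_mktuple.
    by case: ifP; rewrite ?mevalXU ?mevalC.
  have F'p : polymap F' p = polymap F p.
    by rewrite F'E; congr polymap; apply/funext => j; case: ifP.
  apply: (@irreducible_param _ F' (pullback F' gs)) => [|t /V_polymap|x [Sx xp]].
  - apply: contraNneq hp => h0; apply/negPn/negP => /V_polymap.
    by rewrite -F'p => /V_polymap; rewrite h0 meval0 eqxx.
  - rewrite F'E => Vt; split; first by split => //; exact: FZ.
    by apply/coordP => j ij; rewrite ltnNge ij.
  have [t _ tx] := SF x Sx; exists t => //; rewrite F'E -tx; congr polymap.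
  apply/funext => j; case: ltnP => // ij; apply/esym.
  by move: j ij; apply/coordP; rewrite tx.
split=> [|cSc].
  by move=> x [Sx xp]; split => // j ij; apply: xp; apply: ltnW.
(* Moving only parameter [i] away from [p] gives a point of [c i.+1] outside [c i]. *)
have [t [ht ti tp]] := nonroot_off (Ordinal i_n) hp.
have /cSc[_] : c i.+1 (polymap F t).
  split; first by split; [exact: FZ|apply/V_polymap].
  apply/coordP => j ij; apply: tp; apply: contraTneq ij => -> /=; lia.
by move/coordP/(_ (Ordinal i_n) (leqnn _))/eqP; rewrite (negbTE ti).
Qed.

End Param.

(** * Borel orbits *)

Section Orbits.
Variable k : closedFieldType.
Local Notation nilr := (nilradical k).
Implicit Types (x y : nilr).

Lemma ord4_ind (P : 'I_4 -> Prop) :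
  P idx1 -> P idx2 -> P idx3 -> P idx4 -> forall i, P i.
Proof.
move=> P1 P2 P3 P4 [[|[|[|[|//]]]] i4]; rewrite (bool_irrelevance i4 isT) //.
Qed.

Lemma big_ord4 (R : nmodType) (f : 'I_4 -> R) :
  \sum_i f i = f idx1 + f idx2 + f idx3 + f idx4.
Proof.
rewrite !big_ord_recr big_ord0 /= add0r.
by congr (f _ + f _ + f _ + f _); apply: val_inj.
Qed.

Lemma borel_scale (b : 'M[k]_4) :
  is_trig_mx b^T -> (forall i, b i i != 0) ->
  exists2 c, c != 0 & c *: b \in borel k.
Proof.
move=> btrig bd; have detb : \det b != 0.
  by rewrite -det_tr det_trig //; apply/prodf_neq0 => i _; rewrite mxE.
(* [c] is a fourth root of the inverse determinant, since scaling by [c] multiplies the determinant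
   by [c ^+ 4]. *)
have := @solve_monicpoly k 4 (fun i => (\det b)^-1 *+ (i == 0%N)) isT.
case=> c; rewrite big_ord4 /= !mulr0n !mul0r !addr0 expr0 mulr1 => cb.
have c0 : c != 0.
  by apply: contraNneq detb => c0; rewrite -invr_eq0 -[_^-1]cb c0 expr0n.
exists c => //; rewrite !inE detZ cb mulVf // eqxx /=.
apply/is_trig_mxP => i j ij; rewrite !mxE.
by have /is_trig_mxP/(_ i j ij) := btrig; rewrite mxE => ->; rewrite mulr0.
Qed.

Lemma Borbit_intro x y (b : 'M[k]_4) :
  is_trig_mx b^T -> (forall i, b i i != 0) ->
  nil_mx y *m b = b *m nil_mx x -> Borbit x y.
Proof.
move=> btrig bd yb; have [c c0 cb] := borel_scale btrig bd.
exists (c *: b) => //; have bu : c *: b \in unitmx.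
  by move: cb; rewrite unitmxE !inE => /andP[/eqP -> _]; rewrite unitr1.
by apply: (canRL (mulmxK bu)); rewrite -scalemxAr yb scalemxAl.
Qed.

Lemma Borbit_elim x y : Borbit x y ->
  exists b : 'M[k]_4, [/\ is_trig_mx b^T, forall i, b i i != 0 &
    nil_mx y *m b = b *m nil_mx x].
Proof.
case=> b; rewrite !inE => /andP[/eqP detb btrig] ->; exists b; split => //.
  move=> i; have := oner_neq0 k; rewrite -detb -det_tr det_trig //.
  by move/prodf_neq0/(_ i isT); rewrite mxE.
by rewrite mulmxKV // unitmxE detb unitr1.
Qed.

Definition c1 x := nil_coord x (@Ordinal 6 0 isT).
Definition c2 x := nil_coord x (@Ordinal 6 1 isT).
Definition c3 x := nil_coord x (@Ordinal 6 2 isT).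
Definition c12 x := nil_coord x (@Ordinal 6 3 isT).
Definition c23 x := nil_coord x (@Ordinal 6 4 isT).
Definition c13 x := nil_coord x (@Ordinal 6 5 isT).

(** These are the entries of [y *m b = b *m x] above the diagonal. The corner entry of [b] meets
    only zeros of [x] and [y], which leaves nine parameters. Each left side ends with the entry of
    [y] to be solved for, times a diagonal entry of [b]. *)
Lemma BorbitP x y : Borbit x y <->
  exists d1 d2 d3 d4 b12 b23 b34 b13 b24,
  [/\ d1 != 0, d2 != 0, d3 != 0 & d4 != 0] /\
  [/\ c1 y * d2 = d1 * c1 x, c2 y * d3 = d2 * c2 x, c3 y * d4 = d3 * c3 x &
  [/\ c1 y * b23 + c12 y * d3 = d1 * c12 x + b12 * c2 x,
      c2 y * b34 + c23 y * d4 = d2 * c23 x + b23 * c3 x &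
      c1 y * b24 + c12 y * b34 + c13 y * d4
        = d1 * c13 x + b12 * c23 x + b13 * c3 x]].
Proof.
have x0 (z : nilr) :
    (nil_mx z idx1 idx1 = 0) * (nil_mx z idx2 idx1 = 0) *
    (nil_mx z idx2 idx2 = 0) * (nil_mx z idx3 idx1 = 0) *
    (nil_mx z idx3 idx2 = 0) * (nil_mx z idx3 idx3 = 0) *
    (nil_mx z idx4 idx1 = 0) * (nil_mx z idx4 idx2 = 0) *
    (nil_mx z idx4 idx3 = 0) * (nil_mx z idx4 idx4 = 0).
  by do !split; apply: (strict_upperP _ (valP z)).
split=> [/Borbit_elim[b [/is_trig_mxP bt bd yb]]|].
  have b0 : (b idx2 idx1 = 0) * (b idx3 idx1 = 0) * (b idx3 idx2 = 0) *
      (b idx4 idx1 = 0) * (b idx4 idx2 = 0) * (b idx4 idx3 = 0).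
    have b0 (i j : 'I_4) : (j < i)%N -> b i j = 0 by move=> /bt; rewrite mxE.
    by do !split; apply: b0.
  exists (b idx1 idx1), (b idx2 idx2), (b idx3 idx3), (b idx4 idx4).
  exists (b idx1 idx2), (b idx2 idx3), (b idx3 idx4).
  exists (b idx1 idx3), (b idx2 idx4).
  have e i j : \sum_l nil_mx y i l * b l j = \sum_l b i l * nil_mx x l j.
    by move/matrixP/(_ i j) : yb; rewrite !mxE.
  split; first by split.
  have := e idx1 idx2; have := e idx2 idx3; have := e idx3 idx4.
  have := e idx1 idx3; have := e idx2 idx4; have := e idx1 idx4.
  rewrite !big_ord4 !x0 !b0 !(mulr0, mul0r, addr0, add0r).
  by move=> e14 e24 e13 e34 e23 e12; do !split.
move=> [d1 [d2 [d3 [d4 [b12 [b23 [b34 [b13 [b24 [[d1n d2n d3n d4n]]]]]]]]]]].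
move=> [e12 e23 e34 [e13 e24 e14]].
pose b : 'M[k]_4 := \matrix_(i < 4, j < 4) nth 0 (nth [::]
  [:: [:: d1; b12; b13; 0]; [:: 0; d2; b23; b24]; [:: 0; 0; d3; b34];
      [:: 0; 0; 0; d4]] i) j.
apply: (@Borbit_intro _ _ b).
- by apply/is_trig_mxP; apply: ord4_ind; apply: ord4_ind => // _; rewrite !mxE.
- by apply: ord4_ind; rewrite mxE.
apply/matrixP; apply: ord4_ind; apply: ord4_ind; rewrite !mxE !big_ord4 !mxE /=
  !x0 !(mulr0, mul0r, addr0, add0r) //.
Qed.

Lemma solve_last (u a v w : k) : v != 0 -> u + a * v = w -> a = (w - u) / v.
Proof. by move=> v0 <-; rewrite addrAC subrr add0r mulfK. Qed.

Lemma Borbit_refl x : Borbit x x.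
Proof.
apply: (@Borbit_intro _ _ 1%:M); last by rewrite mulmx1 mul1mx.
  by rewrite trmx1 scalar_mx_is_trig.
by move=> i; rewrite mxE eqxx oner_eq0.
Qed.

Ltac solve_coords n2 n3 n4 :=
  move=> [/(canRL (mulfK n2)) -> /(canRL (mulfK n3)) -> /(canRL (mulfK n4)) ->
          [/(solve_last n3) -> /(solve_last n4) -> /(solve_last n4) ->]].

Ltac conj_field := split; [by split; rewrite ?mulf_neq0 ?invr_neq0
  |by do !split; field; do ?[apply/andP; split]].

Lemma Borbit_sym x y : Borbit x y -> Borbit y x.
Proof.
rewrite !BorbitP.
move=> [d1 [d2 [d3 [d4 [b12 [b23 [b34 [b13 [b24 [[n1 n2 n3 n4]]]]]]]]]]].
solve_coords n2 n3 n4.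
(* The entries of the inverse matrix. *)
exists d1^-1, d2^-1, d3^-1, d4^-1, (- b12 / (d1 * d2)), (- b23 / (d2 * d3)),
  (- b34 / (d3 * d4)), ((b12 * b23 - b13 * d2) / (d1 * d2 * d3)),
  ((b23 * b34 - b24 * d3) / (d2 * d3 * d4)).
conj_field.
Qed.

Lemma Borbit_trans x y z : Borbit x y -> Borbit y z -> Borbit x z.
Proof.
rewrite !BorbitP.
move=> [d1 [d2 [d3 [d4 [b12 [b23 [b34 [b13 [b24 [[n1 n2 n3 n4] xy]]]]]]]]]].
move=> [e1 [e2 [e3 [e4 [f12 [f23 [f34 [f13 [f24 [[m1 m2 m3 m4]]]]]]]]]]].
solve_coords m2 m3 m4; move: xy; solve_coords n2 n3 n4.
(* The entries of the product of the two matrices. *)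
exists (e1 * d1), (e2 * d2), (e3 * d3), (e4 * d4), (e1 * b12 + f12 * d2),
  (e2 * b23 + f23 * d3), (e3 * b34 + f34 * d4),
  (e1 * b13 + f12 * b23 + f13 * d3), (e2 * b24 + f23 * b34 + f24 * d4).
conj_field.
Qed.

Lemma Borbit_eq x y : Borbit x y -> Borbit x = Borbit y.
Proof.
move=> xy; apply/seteqP; split=> z; last exact: Borbit_trans xy.
exact: Borbit_trans (Borbit_sym xy).
Qed.

End Orbits.

(** * The sixteen rows *)

Section Rows.
Variable k : closedFieldType.
Local Notation nilr := (nilradical k).
Implicit Types (x y : nilr) (r : orbit_row k).

Definition in_row r x :=
  all (fun f => polyfun f x == 0) (zeros r) &&
  all (fun g => polyfun g x != 0) (nonzeros r).

Lemma Z_all (fs : seq {mpoly k[6]}) x :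
  Z fs x <-> all (fun f => polyfun f x == 0) fs.
Proof.
by split=> [Zx|/allP Zx f /Zx/eqP//]; apply/allP => f /Zx ->.
Qed.

Lemma in_rowP r x : (Z (zeros r) `&` V (nonzeros r)) x <-> in_row r x.
Proof.
split=> [[/Z_all Zx Vx]|/andP[Zx /allP Vx]].
  by apply/andP; split => //; apply/allP.
by split => //; apply/Z_all.
Qed.

Lemma polyfun_coord x :
  (polyfun (X1 k) x = c1 x) * (polyfun (X2 k) x = c2 x) *
  (polyfun (X3 k) x = c3 x) * (polyfun (X12 k) x = c12 x) *
  (polyfun (X23 k) x = c23 x) * (polyfun (X13 k) x = c13 x).
Proof. by do !split; rewrite /polyfun mevalXU. Qed.

(** Up to sign, the minor of rows 1, 2 and columns 3, 4. Where [X1] and [X3] vanish, conjugation by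
    [b] multiplies it by [d1 * d2 / (d3 * d4)]. *)
Lemma polyfun_minor x :
  polyfun (X2 k * X13 k - X12 k * X23 k) x = c2 x * c13 x - c12 x * c23 x.
Proof. by rewrite /polyfun mevalB !mevalM !mevalXU. Qed.

(** The entry of the matrix square of [x] at position (1,4). Where [X2] vanishes, no other entry of
    the square can be nonzero, and conjugation multiplies it by [d1 / d4]. *)
Lemma polyfun_square x :
  polyfun (X12 k * X3 k + X1 k * X23 k) x = c12 x * c3 x + c1 x * c23 x.
Proof. by rewrite /polyfun mevalD !mevalM !mevalXU. Qed.

Definition polyfunE := (polyfun_minor, polyfun_square, polyfun_coord).

(* Rows are numbered from 0, as in [tnth]. *)
Definition row_index x : nat :=
  if c2 x == 0 then
    if c1 x == 0 then
      if c3 x == 0 then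
        if c12 x == 0 then
          if c23 x == 0 then if c13 x == 0 then 0 else 1 else 3
        else if c23 x == 0 then 2 else 7
      else if c12 x == 0 then 6 else 9
    else if c3 x == 0 then if c23 x == 0 then 4 else 10
    else if c12 x * c3 x + c1 x * c23 x == 0 then 11 else 14
  else if c1 x == 0 then
    if c3 x == 0 then
      if c2 x * c13 x - c12 x * c23 x == 0 then 5 else 8
    else 13
  else if c3 x == 0 then 12 else 15.

Lemma row_index_lt x : (row_index x < 16)%N.
Proof. by rewrite /row_index; repeat case: ifP. Qed.

(** A row depends only on which of eight functions vanish: the coordinates, the minor and the entry
    of the square. Given the relations [Q1] and [Q3], a finite check on booleans shows that the rows
    partition the nilradical. *)
Lemma in_rowE (i : 'I_16) x :
  in_row (tnth (orbit_table k) i) x = (row_index x == i).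
Proof.
have Q1 : (c1 x == 0) ==>
    ((c12 x * c3 x + c1 x * c23 x == 0) == (c12 x == 0) || (c3 x == 0)).
  by apply/implyP => /eqP ->; apply/eqP; rewrite mul0r addr0 mulf_eq0.
have Q3 : (c3 x == 0) ==>
    ((c12 x * c3 x + c1 x * c23 x == 0) == (c1 x == 0) || (c23 x == 0)).
  by apply/implyP => /eqP ->; apply/eqP; rewrite mulr0 add0r mulf_eq0.
rewrite /row_index /in_row.
case: i => i i16; rewrite (tnth_nth (OrbitRow (0 : nilr) [::] [::] 0)) /=.
do 16?[case: i i16 => [|i] i16 /=]; rewrite ?polyfunE //; move: Q1 Q3;
  move: (c12 x * c3 x + _ == 0) (c2 x * _ - _ == 0) (c1 x == 0) (c2 x == 0)
    (c3 x == 0) (c12 x == 0) (c23 x == 0) (c13 x == 0);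
  by do 8![case].
Qed.

Lemma nil_coordD x y l : nil_coord (x + y) l = nil_coord x l + nil_coord y l.
Proof. by rewrite /nil_coord [nil_mx _](GRing.valD x y) mxE. Qed.

Lemma nil_coord0 l : nil_coord (0 : nilr) l = 0.
Proof. by rewrite /nil_coord [nil_mx _]GRing.val0 mxE. Qed.

Lemma nil_coord_root (i j : 'I_4) (ij : (i < j)%N) l :
  nil_coord (root_vector k ij) l = (tnth coord_pos l == (i, j))%:R.
Proof. by rewrite /nil_coord mxE -xpair_eqE -surjective_pairing. Qed.

Ltac row_hyps := repeat match goal with
  | |- is_true (_ && _) -> _ => case/andP
  | |- is_true (?a == 0) -> _ => move=> /eqP ->
  | |- is_true (~~ _) -> _ => let H := fresh "nz" in move=> H
  end.

Tactic Notation "borel_entries" uconstr(d1) uconstr(d2) uconstr(d3) uconstr(d4)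
    uconstr(b12) uconstr(b23) uconstr(b34) uconstr(b13) uconstr(b24) :=
  exists d1, d2, d3, d4, b12, b23, b34, b13, b24;
  split; [split; rewrite ?mulf_neq0 ?invr_neq0 ?oner_neq0
        |split; [field|field|field|split; field]; do ?[apply/andP; split]].

Lemma BorbitE (i : 'I_16) x :
  Borbit (rep (tnth (orbit_table k) i)) x <-> in_row (tnth (orbit_table k) i) x.
Proof.
case: i => i i16; rewrite (tnth_nth (OrbitRow (0 : nilr) [::] [::] 0)) /=.
rewrite BorbitP.
do 16?[case: i i16 => [|i] i16 /=]; rewrite /in_row /= ?polyfunE //;
  move: (c1 x) (c2 x) (c3 x) (c12 x) (c23 x) (c13 x) => a1 a2 a3 a12 a23 a13;
  rewrite /c1 /c2 /c3 /c12 /c23 /c13 !(nil_coordD, nil_coord0, nil_coord_root) /=;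
  (* From orbit to row, the coordinates are solved for and substituted; the five goals that stay
     open concern the minor or the entry of the square. *)
  (split;
  [move=> [d1 [d2 [d3 [d4 [b12 [b23 [b34 [b13 [b24 [[n1 n2 n3 n4]]]]]]]]]]];
   rewrite !(mulr0, mulr1, addr0, add0r);
   move=> [/(canRL (mulfK n2))-> /(canRL (mulfK n3))-> /(canRL (mulfK n4))->];
   rewrite ?mul0r ?sub0r ?addr0 ?add0r;
   move=> [e1 e2];
   try (move: e1 => /(canRL (mulfK n3)) ->);
   try (move: e1 => /(solve_last n3) ->);
   try (move: e2 => /(canRL (mulfK n4)) ->);
   try (move: e2 => /(solve_last n4) ->);
   rewrite ?mul0r ?sub0r ?addr0 ?add0r ?subr0;
   try move/(canRL (mulfK n4)) ->;
   try move/(solve_last n4) ->;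
   rewrite ?mul0r ?sub0r ?addr0 ?add0r ?subr0;
   rewrite ?eqxx ?mulf_neq0 ?invr_neq0 //=
  |rewrite ?andbT /=]).
(* From row to orbit, [b] is normalized by [d4 = 1] and solved from the equations; free diagonal
   entries are 1, free off-diagonal ones 0. *)
- by row_hyps; borel_entries 1 1 1 1 0 0 0 0 0.
- by row_hyps; borel_entries a13 1 1 1 0 0 0 0 0.
- by row_hyps; borel_entries a12 1 1 1 0 0 (- a13 / a12) 0 0.
- by row_hyps; borel_entries 1 a23 1 1 a13 0 0 0 0.
- by row_hyps; borel_entries a1 1 1 1 0 (- a12 / a1) 0 0 (- a13 / a1).
- by rewrite !andbT; apply/eqP; field; rewrite ?n1 ?n2 ?n3 ?n4.
- case/andP => /and3P[/eqP-> /eqP->]; rewrite subr_eq0 => /eqP P0 nz.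
  have -> : a13 = a12 * a23 / a2 by rewrite -P0 mulrC mulKf.
  by borel_entries 1 a2 1 1 a12 0 (- a23 / a2) 0 0.
- by row_hyps; borel_entries 1 1 a3 1 0 a23 0 a13 0.
- by row_hyps; borel_entries a12 a23 1 1 a13 0 0 0 0.
- rewrite andbT (_ : _ - _ = d1 * d2 / (d3 * d4)) ?mulf_neq0 ?invr_neq0 ?mulf_neq0 //.
  by field; rewrite ?n1 ?n2 ?n3 ?n4.
(* Clearing position (2,4) forces [b34]; position (1,4) then makes [d1] the minor divided by
   [a2]. *)
- row_hyps.
  by borel_entries ((a2 * a13 - a12 * a23) / a2) a2 1 1 a12 0 (- a23 / a2) 0 0.
- row_hyps; move: nz; rewrite mul0r addr0 mulf_eq0 negb_or => /andP[n12 n3].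
  by borel_entries (a12 * a3) 1 a3 1 0 a23 0 a13 0.
- by move=> _; rewrite mulr0 add0r andbT !mulf_neq0 ?invr_neq0.
- row_hyps; move: nz; rewrite mulr0 add0r mulf_eq0 negb_or => /andP[n1 n23].
  by borel_entries (a1 * a23) a23 1 1 a13 (- a12 / a1) 0 0 0.
- by move=> _; rewrite !andbT; apply/eqP; field; rewrite ?n1 ?n2 ?n3 ?n4.
- case/andP => /andP[/eqP->]; rewrite addr_eq0 => /eqP Q0 /andP[n1 n3].
  have -> : a12 = - (a1 * a23) / a3 by rewrite -Q0 mulfK.
  by borel_entries a1 1 a3 1 0 a23 0 a13 0.
- row_hyps.
  by borel_entries (a1 * a2) a2 1 1 a12 0 (- a23 / a2) 0
    ((a12 * a23 / a2 - a13) / a1).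
- by row_hyps; borel_entries 1 (a2 * a3) a3 1 (a12 * a3) a23 0 a13 0.
- move=> _; rewrite andbT (_ : _ + _ = d1 / d4) ?mulf_neq0 ?invr_neq0 //.
  by field; rewrite ?n1 ?n2 ?n3 ?n4.
(* Eliminating [b23] between positions (1,3) and (2,4) gives [a1 * d2 = a12 * a3 + a1 * a23], which
   is also [d1]. *)
- row_hyps.
  by borel_entries (a12 * a3 + a1 * a23) ((a12 * a3 + a1 * a23) / a1) a3 1
    0 (- (a12 * a3) / a1) 0 a13 0.
- row_hyps.
  by borel_entries (a1 * a2 * a3) (a2 * a3) a3 1 (a1 * a23 + a12 * a3) a23 0 a13 0.
Qed.

End Rows.

(** * Dimensions and closures *)

Section Geometry.
Variable k : closedFieldType.
Local Notation nilr := (nilradical k).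
Implicit Types (x y : nilr) (r : orbit_row k).

Definition row_geometry r :=
  has_dimension (Z (zeros r) `&` V (nonzeros r)) (dimension r) /\
  closure (Z (zeros r) `&` V (nonzeros r)) = Z (zeros r).

(** For [s] without repetition each sum has at most one term, and the map is the inclusion of a
    coordinate subspace. *)
Definition subspace_map n (s : n.-tuple 'I_6) : 6.-tuple {mpoly k[n]} :=
  [tuple \sum_(j < n | tnth s j == l) 'X_j | l < 6].

Lemma subspace_mapE n (s : n.-tuple 'I_6) t l :
  nil_coord (polymap (subspace_map s) t) l = \sum_(j < n | tnth s j == l) t j.
Proof.
rewrite nil_vecK tnth_mktuple raddf_sum /=.
by apply: eq_bigr => j _; rewrite mevalXU.
Qed.

(** This covers the fourteen rows whose closed set is a coordinate subspace: [s] lists its free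
    coordinates, which serve as parameters, and [z] the vanishing ones. *)
Lemma subspace_geometry r n (s : n.-tuple 'I_6) (z : seq 'I_6) :
  dimension r = n -> zeros r = [seq 'X_l | l <- z] ->
  uniq s -> (forall l, (l \in z) = (l \notin s)) ->
  (Z (zeros r) `&` V (nonzeros r)) (rep r) -> row_geometry r.
Proof.
move=> rn rz s_uniq zs Sr.
have Zs x : Z (zeros r) x <-> forall l, l \notin s -> nil_coord x l = 0.
  rewrite Z_all rz all_map; split=> [/allP zx l|sx].
    by rewrite -zs => /zx /=; rewrite /polyfun mevalXU => /eqP.
  by apply/allP => l; rewrite zs => /sx /= xl; rewrite /polyfun mevalXU xl.
have sj t j : nil_coord (polymap (subspace_map s) t) (tnth s j) = t j.
  rewrite subspace_mapE (big_pred1 j) // => i.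
  by rewrite !(tnth_nth ord0) nth_uniq ?size_tuple.
have FZ t : Z (zeros r) (polymap (subspace_map s) t).
  apply/Zs => l ls; rewrite subspace_mapE big1 // => j /eqP sl.
  by rewrite -sl mem_tnth in ls.
have ZF : Z (zeros r) `<=` range (polymap (subspace_map s)).
  move=> x /Zs xs; exists (fun j => nil_coord x (tnth s j)) => //.
  apply: nil_coord_inj => l; have [/tnthP[j ->]|ls] := boolP (l \in s).
    by rewrite sj.
  rewrite xs // subspace_mapE big1 // => j /eqP sl.
  by rewrite -sl mem_tnth in ls.
split.
  rewrite rn.
  apply: (@dimension_param _ _ (subspace_map s) (tnth s) _ _ (rep r)) => //.
    by move=> x [/ZF].
  by move=> t j _; rewrite sj.
by apply: (closure_param FZ ZF); exists (rep r).
Qed.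

(** Writing a singular 2 by 2 matrix as a column times a row reaches every point of the two
    quadrics, also where a pivot vanishes. *)
Lemma rank1_factor (K : fieldType) (a b c d : K) : a * d = b * c ->
  exists u1 u2 v1 v2, [/\ a = u1 * v1, b = u1 * v2, c = u2 * v1 & d = u2 * v2].
Proof.
move=> e; have [a0|a0] := eqVneq a 0.
  have /eqP := e; rewrite a0 mul0r eq_sym mulf_eq0 => /orP[] /eqP ->.
    by exists 0, 1, c, d; rewrite !(mul0r, mul1r).
  by exists b, d, 0, 1; rewrite !(mulr0, mulr1).
by exists a, c, 1, (b / a); rewrite !mulr1 mulrCA divff // mulr1;
  split => //; rewrite mulrA [c * b]mulrC -e mulrAC divff // mul1r.
Qed.

Local Notation o i := (@Ordinal 6 i isT).

Lemma coord_inj x y : c1 x = c1 y -> c2 x = c2 y -> c3 x = c3 y ->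
  c12 x = c12 y -> c23 x = c23 y -> c13 x = c13 y -> x = y.
Proof.
move=> e1 e2 e3 e12 e23 e13; apply: nil_coord_inj.
by case=> -[|[|[|[|[|[|//]]]]]] i; rewrite (bool_irrelevance i isT).
Qed.

Ltac eval_coord := rewrite /c1 /c2 /c3 /c12 /c23 /c13 !nil_vecK /=
  !(mevalM, mevalN, mevalXU, meval0) /=.

Lemma inordE n i (i_n : (i < n.+1)%N) : inord i = Ordinal i_n.
Proof. by apply/val_inj; rewrite /= inordK. Qed.

Lemma minor_geometry r :
  rep r = x2 k -> zeros r = [:: X1 k; X3 k; X2 k * X13 k - X12 k * X23 k] ->
  nonzeros r = [:: X2 k] -> dimension r = 3 ->
  (Z (zeros r) `&` V (nonzeros r)) (rep r) -> row_geometry r.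
Proof.
move=> rr rz rv rd Sr; rewrite /row_geometry.
split.
  (* The parameters are X12 / X2, X23 / X2 and X2: this misses the points of the
     quadric with X2 = 0, so the closure needs another parametrization. *)
  pose F : 6.-tuple {mpoly k[3]} := [tuple 0; 'X_(inord 2); 0;
    'X_(inord 2) * 'X_(inord 0); 'X_(inord 2) * 'X_(inord 1);
    'X_(inord 2) * 'X_(inord 0) * 'X_(inord 1)].
  rewrite rd.
  (* [X2] is listed last and hence fixed first, at its value 1 on [x2 k]; then [X12] and [X23] equal
     the first two parameters. *)
  apply: (@dimension_param _ _ F (tnth [tuple o 3; o 4; o 1]) _ _ (rep r)) => //.
  - move=> t; apply/Z_all; rewrite rz /= !polyfunE; eval_coord.
    by rewrite eqxx /= andbT; apply/eqP; ring.
  - move=> x /in_rowP; rewrite /in_row rz rv /= !polyfunE !andbT.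
    move=> /andP[/and3P[/eqP h1 /eqP h3]]; rewrite subr_eq0 => /eqP P0 n2.
    exists (fun j : 'I_3 => nth 0 [:: c12 x / c2 x; c23 x / c2 x; c2 x] j) => //.
    have h13 : c13 x = c12 x * c23 x / c2 x by rewrite -P0 mulrC mulKf.
    apply: coord_inj; rewrite ?h1 ?h3 ?h13; eval_coord;
      by rewrite ?inordK //=; field.
  rewrite rr => t [[|[|[|//]]] j3] tj.
  - have := tj (inord 2); rewrite inordK // => /(_ isT).
    rewrite nil_vecK !nil_coord_root !(tnth_nth (o 0)) inordK //= => t2.
    by rewrite mevalM !mevalXU t2 mul1r inordE.
  - have := tj (inord 2); rewrite inordK // => /(_ isT).
    rewrite nil_vecK !nil_coord_root !(tnth_nth (o 0)) inordK //= => t2.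
    by rewrite mevalM !mevalXU t2 mul1r inordE.
  by rewrite nil_vecK !(tnth_nth (o 0)) /= mevalXU inordE.
(* Column times row covers the whole quadric; the surplus parameter does not affect the closure. *)
pose G : 6.-tuple {mpoly k[4]} := [tuple 0; 'X_idx1 * 'X_idx3; 0;
  'X_idx1 * 'X_idx4; 'X_idx2 * 'X_idx3; 'X_idx2 * 'X_idx4].
apply: (@closure_param _ _ G); last by exists (rep r).
- move=> t; apply/Z_all; rewrite rz /= !polyfunE; eval_coord.
  by rewrite eqxx /= andbT; apply/eqP; ring.
move=> x /Z_all; rewrite rz /= !polyfunE andbT subr_eq0.
move=> /and3P[/eqP h1 /eqP h3 /eqP /rank1_factor[u1 [u2 [v1 [v2 [h2 h12 h23 h13]]]]]].
exists (fun j : 'I_4 => nth 0 [:: u1; u2; v1; v2] j) => //.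
by apply: coord_inj; rewrite ?h1 ?h2 ?h3 ?h12 ?h13 ?h23; eval_coord.
Qed.

Lemma square_geometry r :
  rep r = x1 k + x3 k -> zeros r = [:: X2 k; X12 k * X3 k + X1 k * X23 k] ->
  nonzeros r = [:: X1 k; X3 k] -> dimension r = 4 ->
  (Z (zeros r) `&` V (nonzeros r)) (rep r) -> row_geometry r.
Proof.
move=> rr rz rv rd Sr; rewrite /row_geometry.
split.
  (* The parameters are [X13], [X12 / X1], [X3] and [X1]. Once [X1] is fixed at 1, [X12] equals the
     second one. *)
  pose F : 6.-tuple {mpoly k[4]} := [tuple 'X_idx4; 0; 'X_idx3;
    'X_idx4 * 'X_idx2; - ('X_idx3 * 'X_idx2); 'X_idx1].
  rewrite rd.
  apply: (@dimension_param _ _ F (tnth [tuple o 5; o 3; o 2; o 0]) _ _ (rep r))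
    => //.
  - move=> t; apply/Z_all; rewrite rz /= !polyfunE; eval_coord.
    by rewrite eqxx /= andbT; apply/eqP; ring.
  - move=> x /in_rowP; rewrite /in_row rz rv /= !polyfunE !andbT addr_eq0.
    move=> /andP[/andP[/eqP h2 /eqP Q0] /andP[n1 n3]].
    exists (fun j : 'I_4 => nth 0 [:: c13 x; c12 x / c1 x; c3 x; c1 x] j) => //.
    have h23 : c23 x = - (c12 x * c3 x) / c1 x by rewrite Q0 opprK mulrC mulKf.
    by apply: coord_inj; rewrite ?h2 ?h23; eval_coord => //; field.
  move=> t; apply: ord4_ind => tj; rewrite nil_vecK /= ?mevalM !mevalXU //.
  have := tj idx4 isT; rewrite rr nil_coordD !nil_coord_root /= addr0 => ->.
  by rewrite mul1r.
pose G : 6.-tuple {mpoly k[5]} := [tuple 'X_(inord 0) * 'X_(inord 2); 0;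
  - ('X_(inord 1) * 'X_(inord 2)); 'X_(inord 0) * 'X_(inord 3);
  'X_(inord 1) * 'X_(inord 3); 'X_(inord 4)].
apply: (@closure_param _ _ G); last by exists (rep r).
- move=> t; apply/Z_all; rewrite rz /= !polyfunE; eval_coord.
  by rewrite eqxx /= andbT; apply/eqP; ring.
move=> x /Z_all; rewrite rz /= !polyfunE andbT addr_eq0 => /andP[/eqP h2 /eqP Q0].
have /rank1_factor[u1 [u2 [v1 [v2 [h1 h12 h3 h23]]]]] : c1 x * c23 x = c12 x * (- c3 x).
  by rewrite mulrN Q0 opprK.
exists (fun j : 'I_5 => nth 0 [:: u1; u2; v1; v2; c13 x] j) => //.
have {}h3 : c3 x = - (u2 * v1) by rewrite -h3 opprK.
by apply: coord_inj; rewrite ?h1 ?h2 ?h3 ?h12 ?h23; eval_coord; rewrite ?inordK.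
Qed.

Ltac case_ord6 := case=> -[|[|[|[|[|[|]]]]]].

Lemma row_geometry_all (i : 'I_16) : row_geometry (tnth (orbit_table k) i).
Proof.
have Sr : (Z (zeros (tnth (orbit_table k) i)) `&`
    V (nonzeros (tnth (orbit_table k) i))) (rep (tnth (orbit_table k) i)).
  exact/in_rowP/BorbitE/Borbit_refl.
move: Sr; case: i => i i16.
rewrite (tnth_nth (OrbitRow (0 : nilr) [::] [::] 0)) /=.
do 16?[case: i i16 => [|i] i16 /=] => // Sr.
- apply: (@subspace_geometry _ _ [tuple] [:: o 0; o 1; o 2; o 3; o 4; o 5]) => //.
  by case_ord6.
- apply: (@subspace_geometry _ _ [tuple o 5] [:: o 0; o 1; o 2; o 3; o 4]) => //.
  by case_ord6.
- apply: (@subspace_geometry _ _ [tuple o 3; o 5] [:: o 0; o 1; o 2; o 4]) => //.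
  by case_ord6.
- apply: (@subspace_geometry _ _ [tuple o 4; o 5] [:: o 0; o 1; o 2; o 3]) => //.
  by case_ord6.
- apply: (@subspace_geometry _ _ [tuple o 0; o 3; o 5] [:: o 1; o 2; o 4]) => //.
  by case_ord6.
- exact: minor_geometry.
- apply: (@subspace_geometry _ _ [tuple o 2; o 4; o 5] [:: o 0; o 1; o 3]) => //.
  by case_ord6.
- apply: (@subspace_geometry _ _ [tuple o 3; o 4; o 5] [:: o 0; o 1; o 2]) => //.
  by case_ord6.
- apply: (@subspace_geometry _ _ [tuple o 1; o 3; o 4; o 5] [:: o 0; o 2]) => //.
  by case_ord6.
- apply: (@subspace_geometry _ _ [tuple o 2; o 3; o 4; o 5] [:: o 0; o 1]) => //.
  by case_ord6.
- apply: (@subspace_geometry _ _ [tuple o 0; o 3; o 4; o 5] [:: o 1; o 2]) => //.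
  by case_ord6.
- exact: square_geometry.
- apply: (@subspace_geometry _ _ [tuple o 0; o 1; o 3; o 4; o 5] [:: o 2]) => //.
  by case_ord6.
- apply: (@subspace_geometry _ _ [tuple o 1; o 2; o 3; o 4; o 5] [:: o 0]) => //.
  by case_ord6.
- apply: (@subspace_geometry _ _ [tuple o 0; o 2; o 3; o 4; o 5] [:: o 1]) => //.
  by case_ord6.
- apply: (@subspace_geometry _ _ [tuple o 0; o 1; o 2; o 3; o 4; o 5] [::]) => //.
  by case_ord6.
Qed.

End Geometry.

Theorem proposition5 (k : closedFieldType) :
  let row := tnth (orbit_table k) in
  [/\ (Borbits k #= `I_16)%card,
      modality0 k,
      Borbits k = [set Borbit (rep (row i)) | i in [set: 'I_16]],
      forall i : 'I_16,
        [/\ Borbit (rep (row i)) = Z (zeros (row i)) `&` V (nonzeros (row i)),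
            has_dimension (Borbit (rep (row i))) (dimension (row i)) &
            closure (Borbit (rep (row i))) = Z (zeros (row i))] &
      forall i j : 'I_16,
        orbit_le (Borbit (rep (row i))) (Borbit (rep (row j))) <->
        Z (zeros (row i)) `<=` Z (zeros (row j))].
Proof.
move=> row.
have orbitE i : Borbit (rep (row i)) = Z (zeros (row i)) `&` V (nonzeros (row i)).
  by apply/seteqP; split=> x; rewrite BorbitE in_rowP.
have closureE i : closure (Borbit (rep (row i))) = Z (zeros (row i)).
  by rewrite orbitE; case: (row_geometry_all k i).
have orbit_index i x : Borbit (rep (row i)) x <-> row_index x = i.
  by rewrite BorbitE in_rowE; split=> /eqP.
have rep_index i : row_index (rep (row i)) = i by apply/orbit_index/Borbit_refl.
have orbits : Borbits k = [set Borbit (rep (row i)) | i in [set: 'I_16]].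
  apply/seteqP; split=> [_ [x _ <-]|_ [i _ <-]]; last by exists (rep (row i)).
  exists (Ordinal (row_index_lt x)) => //; apply: Borbit_eq.
  exact/orbit_index.
have card16 : (Borbits k #= `I_16)%card.
  rewrite orbits; apply: card_eq_trans (card_esym (card_II)).
  (* [row_index] is constant on each of these orbits and takes the value [i] at the [i]-th
     representative, so the orbits are distinct. *)
  apply: inj_card_eq => i j _ _ ij; apply/val_inj => /=.
  rewrite -[RHS](iffLR (orbit_index j (rep (row i)))) ?rep_index //.
  by rewrite -ij; apply: Borbit_refl.
split=> //; first by exists 16.
  by move=> i; split=> //; rewrite orbitE; case: (row_geometry_all k i).
move=> i j; rewrite /orbit_le closureE; split=> [ij|]; last first.
  by apply: subset_trans; rewrite orbitE; exact: subIsetl.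
(* As the target is closed, the inclusion of the orbit passes to its closure. *)
have /closure_id -> := @Z_closed k (zeros (row j)).
by rewrite -closureE; apply: closureS.
Qed.
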